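(* Let $F$, $\Psi$, $\mathbf{R}$, $\mathbf{r}$, $\mathbf{B}$, $\mathbf{A}$, $\mathbf{V}$, $\Theta$, $(\mathbf{D}_n)_{n\ge1}$ and the sequence $(\mathbf{h}_n)_{n\ge1}$ generated by the (batch) MM subspace algorithm be as described in the context, with all the assumptions stated there. Let $\epsilon\in\,]0,+\infty[$ be such that $\epsilon\mathbf{I}_N\prec\mathbf{R}$. Let $\underline{\eta}>0$ be the minimum eigenvalue of $\mathbf{R}$ and $\overline{\eta}$ the maximum eigenvalue of $\mathbf{R}+\mathbf{V}$. For every $n$, let $\overline{\kappa}_n$ be the maximum eigenvalue of $\big(\mathbf{A}(\mathbf{h}_n)\big)^{1/2}\big(\nabla^2F(\mathbf{h}_n)\big)^{-1}\big(\mathbf{A}(\mathbf{h}_n)\big)^{1/2}$. Then there exist $n_\epsilon\in\mathbb{N}^*$ and $\overline{\kappa}_{\max}\in[1,+\infty[$ such that $\overline{\kappa}_n\le\overline{\kappa}_{\max}$ for every $n\ge n_\epsilon$ and such that, setting $$\vartheta=1-\frac{1}{(1+\epsilon)\overline{\kappa}_{\max}}\left(1-\Big(\frac{\overline{\eta}-\underline{\eta}+2\epsilon}{\overline{\eta}+\underline{\eta}}\Big)^2\right),\qquad \mu=\frac{F(\mathbf{h}_{n_\epsilon})-\inf F}{\vartheta^{n_\epsilon}},$$ one has $\vartheta\in\,]0,1[$ and, for every $n\ge n_\epsilon$, $$\frac12\underline{\eta}\,\|\mathbf{h}_n-\widehat{\mathbf{h}}\|^2\le F(\mathbf{h}_n)-\inf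 F\le\mu\,\vartheta^n,$$ where $\widehat{\mathbf{h}}$ is the unique global minimizer of $F$. In particular, $(\mathbf{h}_n)_{n\ge1}$ converges linearly to $\widehat{\mathbf{h}}$ with rate $\sqrt{\vartheta}$.
   Context: Notation: $\mathbb{N}^*=\{1,2,\dots\}$; $\preceq$ and $\prec$ are the weak and strict Loewner orders on symmetric matrices; $\mathbf{I}_N$ is the $N\times N$ identity; $\operatorname{ran}$ is the range of a matrix; $\|\cdot\|$ is the Euclidean norm. Cost function. $F\colon\mathbb{R}^N\to\mathbb{R}$, $F(\mathbf{h})=\frac12\mathbf{h}^\top\mathbf{R}\mathbf{h}-\mathbf{r}^\top\mathbf{h}+\Psi(\mathbf{h})$, where $\mathbf{r}\in\mathbb{R}^N$, $\mathbf{R}\in\mathbb{R}^{N\times N}$ is symmetric positive definite, and $\Psi\colon\mathbb{R}^N\to\mathbb{R}$ is lower-bounded, twice-continuously differentiable and convex. Majorant. $\mathbf{B}$ assigns to each $\mathbf{h}\in\mathbb{R}^N$ a symmetric nonnegative definite matrix $\mathbf{B}(\mathbf{h})\in\mathbb{R}^{N\times N}$, $\mathbf{A}(\mathbf{h})=\mathbf{R}+\mathbf{B}(\mathbf{h})$, and $$\Theta(\mathbf{h},\mathbf{h}_n)=F(\mathbf{h}_n)+\nabla F(\mathbf{h}_n)^\top(\mathbf{h}-\mathbf{h}_n)+\tfrac12(\mathbf{h}-\mathbf{h}_n)^\top\mathbf{A}(\mathbf{h}_n)(\mathbf{h}-\mathbf{h}_n).$$ It is assumed that, for every $n\in\mathbb{N}^*$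 and every $\mathbf{h}\in\mathbb{R}^N$, $F(\mathbf{h})-F(\mathbf{h}_n)\le\Theta(\mathbf{h},\mathbf{h}_n)-\Theta(\mathbf{h}_n,\mathbf{h}_n)$. Batch MM subspace algorithm. $\mathbf{h}_1\in\mathbb{R}^N$ is an initial value and, for every $n\in\mathbb{N}^*$, $\mathbf{h}_{n+1}\in\operatorname{Argmin}_{\mathbf{h}\in\operatorname{ran}\mathbf{D}_n}\Theta(\mathbf{h},\mathbf{h}_n)$, where $\mathbf{D}_n\in\mathbb{R}^{N\times M_n}$, $M_n\ge1$. Assumptions. (i) For every $n\in\mathbb{N}^*$, $\{\nabla F(\mathbf{h}_n),\mathbf{h}_n\}\subset\operatorname{ran}\mathbf{D}_n$; (ii) $\mathbf{V}$ is a positive definite matrix such that, for every $n\in\mathbb{N}^*$, $\nabla^2\Psi(\mathbf{h}_n)\preceq\mathbf{B}(\mathbf{h}_n)\preceq\mathbf{V}$. *)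

(* Defs.v *)
From HB Require Import structures.
From mathcomp Require Import all_boot all_order all_algebra.
From mathcomp Require Import all_classical all_reals all_analysis.

Set Implicit Arguments.
Unset Strict Implicit.
Unset Printing Implicit Defensive.

Import Order.TTheory GRing.Theory Num.Theory.
Import numFieldNormedType.Exports.

Local Open Scope classical_set_scope.
Local Open Scope ring_scope.

Section EuclideanSpace.
Context {R : realType} {N : nat}.
Implicit Types (x y : 'cV[R]_N) (A B : 'M[R]_N) (f : 'cV[R]_N -> R).

Definition dot x y : R := (x^T *m y) 0 0.

(* The norm `|x| of the library is the sup norm. *)
Definition norm2 x : R := Num.sqrt (dot x x).

Definition qform A x : R := dot x (A *m x).

(* The Loewner orders are only used between symmetric matrices; symmetry is
   not part of these relations. *)
Definition loewner_le A B : Prop := forall x, qform A x <= qform B x.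

Definition loewner_lt A B : Prop := forall x, x != 0 -> qform A x < qform B x.

Definition nonneg_definite A : Prop := A^T = A /\ loewner_le 0 A.

Definition pos_definite A : Prop := A^T = A /\ loewner_lt 0 A.

(* The square root of a symmetric nonnegative definite A is the unique
   symmetric nonnegative definite S with S S = A. *)
Definition mxsqrt A : 'M[R]_N :=
  xget 0 [set S : 'M[R]_N | nonneg_definite S /\ S *m S = A].

Definition is_min_eigenvalue A (a : R) : Prop :=
  eigenvalue A a /\ forall b, eigenvalue A b -> a <= b.

Definition is_max_eigenvalue A (a : R) : Prop :=
  eigenvalue A a /\ forall b, eigenvalue A b -> b <= a.

Definition gradient f x : 'cV[R]_N := \col_i 'D_(delta_mx i 0) f x.

Definition hessian f x : 'M[R]_N :=
  \matrix_(i, j) 'D_(delta_mx j 0) (fun y => gradient f y i 0) x.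

Definition twice_continuously_differentiable f : Prop :=
  [/\ forall x, differentiable f x,
      forall x, differentiable (gradient f) x
    & continuous (hessian f)].

Definition argmin f (S : set 'cV[R]_N) : set 'cV[R]_N :=
  [set x | S x /\ forall y, S y -> f x <= f y].

Definition ran m (D : 'M[R]_(N, m)) : set 'cV[R]_N :=
  range (fun u : 'cV[R]_m => D *m u).

(* R-linear convergence: the error is eventually dominated by a geometric
   sequence of ratio q. *)
Definition converges_linearly (u : nat -> 'cV[R]_N) x (q : R) : Prop :=
  [/\ u @ \oo --> x, 0 <= q < 1
    & exists C : R, \forall n \near \oo, norm2 (u n - x) <= C * q ^+ n].

Definition cost (Q : 'M[R]_N) (r : 'cV[R]_N) (Psi : 'cV[R]_N -> R) x : R :=
  2^-1 * qform Q x - dot r x + Psi x.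

Definition majorant f (A : 'cV[R]_N -> 'M[R]_N) x y : R :=
  f y + dot (gradient f y) (x - y) + 2^-1 * qform (A y) (x - y).

End EuclideanSpace.

(* Main.v *)
Require Import Defs.
From HB Require Import structures.
From mathcomp Require Import all_boot all_order all_algebra.
From mathcomp Require Import all_classical all_reals all_analysis.
From mathcomp Require Import complex ring lra.

Set Implicit Arguments.
Unset Strict Implicit.
Unset Printing Implicit Defensive.

Import Order.TTheory GRing.Theory Num.Theory.
Import numFieldNormedType.Exports.

Local Open Scope classical_set_scope.
Local Open Scope ring_scope.

(** The cost is strongly convex, its Hessian [H x = R + hessian Psi x] being at
    least [R]. The line through an iterate [x] along the gradient [g] lies in the
    search space, so the next iterate does at least as well for the majorant as
    any point of this line ([mm_step_descent]). With [A = A x], the cost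
    therefore decreases by at least [(g^T g)^2 / (2 g^T A g)].

    The iterates converge to the minimizer [z]: with the fixed step
    [1 / eta_max] the decrease is at least a fixed fraction of [g^T g], hence of
    the gap [F x - inf F] ([gradient_dominates_inf]), and the gap controls the
    distance to [z] ([quadratic_growth]). Existence of [z] also comes from strong
    convexity, which makes minimizing sequences Cauchy
    ([strongly_convex_minimizer]).

    The announced rate is a comparison of the decrease with the gap. Close to
    [z] the Hessian is almost constant, so Taylor's formula bounds the gap by
    [(1 + eps) / 2 * g^T H^-1 g] ([near_newton_decrement]). The number [kappa]
    bounds [g^T H^-1 g] by [kappa * g^T A^-1 g], and Kantorovich's inequality
    bounds [g^T A^-1 g] by a multiple of [(g^T g)^2 / g^T A g]
    ([preconditioned_kantorovich]). As the spectrum of [A] lies between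
    [eta_min] and [eta_max], each step multiplies the gap by at most
    [1 - 4 eta_min eta_max / ((1 + eps) kappa_max (eta_min + eta_max)^2)]
    ([gradient_step_contraction]), which is at most [theta]. Here
    [kappa_max = eta_max / eta_min] bounds every [kappa n]
    ([condition_number_le]).

    This rests on three classical facts proved below: Rayleigh's bounds for the
    extreme eigenvalues of a symmetric matrix ([max_eigenvalue_qform]), the
    existence of square roots of nonnegative definite matrices
    ([nonneg_sqrt_exists]) and the symmetry of the Hessian ([hessian_sym]). *)

(** * Scalar product and quadratic forms *)

Section Dot.
Context {K : realType} {N : nat}.
Implicit Types (x y z : 'cV[K]_N) (A B S : 'M[K]_N) (a t : K).

Lemma dotE x y : dot x y = \sum_i x i 0 * y i 0.
Proof. by rewrite /dot mxE; apply: eq_bigr => i _; rewrite mxE. Qed.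

Lemma dotC x y : dot x y = dot y x.
Proof. by rewrite !dotE; apply: eq_bigr => i _; rewrite mulrC. Qed.

Lemma dotDr x y z : dot x (y + z) = dot x y + dot x z.
Proof. by rewrite /dot mulmxDr mxE. Qed.

Lemma dotNr x y : dot x (- y) = - dot x y.
Proof. by rewrite /dot mulmxN mxE. Qed.

Lemma dotZr a x y : dot x (a *: y) = a * dot x y.
Proof. by rewrite /dot -scalemxAr mxE. Qed.

Lemma dotDl x y z : dot (y + z) x = dot y x + dot z x.
Proof. by rewrite dotC dotDr !(dotC x). Qed.

Lemma dotNl x y : dot (- y) x = - dot y x.
Proof. by rewrite dotC dotNr dotC. Qed.

Lemma dotZl a x y : dot (a *: y) x = a * dot y x.
Proof. by rewrite dotC dotZr dotC. Qed.

Definition dotlin := (dotDr, dotNr, dotZr, dotDl, dotNl, dotZl).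

Lemma dot_tr A x y : dot x (A *m y) = dot (A^T *m x) y.
Proof. by rewrite /dot trmx_mul trmxK mulmxA. Qed.

Lemma dot_sym A x y : A^T = A -> dot x (A *m y) = dot y (A *m x).
Proof. by move=> sA; rewrite dot_tr sA dotC. Qed.

Lemma dot_delta i x : dot (delta_mx i 0) x = x i 0.
Proof.
rewrite dotE (bigD1 i) //= big1 ?addr0 => [|j ji]; rewrite !mxE ?eqxx ?mul1r//.
by rewrite (negbTE ji) mul0r.
Qed.

Lemma dot_ge0 x : 0 <= dot x x.
Proof. by rewrite dotE sumr_ge0// => i _; rewrite -expr2 sqr_ge0. Qed.

Lemma sqr_entry_le_dot x i : x i 0 ^+ 2 <= dot x x.
Proof.
rewrite dotE (bigD1 i)//= -expr2 lerDl sumr_ge0// => j _.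
by rewrite -expr2 sqr_ge0.
Qed.

Lemma dot_gt0 x : x != 0 -> 0 < dot x x.
Proof.
move=> x0; rewrite lt_def dot_ge0 andbT; apply: contra x0 => /eqP d0.
apply/eqP/matrixP => i j; rewrite ord1 mxE; apply/eqP.
by rewrite -sqrf_eq0 eq_le sqr_ge0 andbT -d0 sqr_entry_le_dot.
Qed.

Lemma qform0 A : qform A 0 = 0.
Proof. by rewrite /qform mulmx0 /dot mulmx0 mxE. Qed.

Lemma qformD A B x : qform (A + B) x = qform A x + qform B x.
Proof. by rewrite /qform mulmxDl dotDr. Qed.

Lemma qformN A x : qform (- A) x = - qform A x.
Proof. by rewrite /qform mulNmx dotNr. Qed.

Lemma qform_scalar a x : qform a%:M x = a * dot x x.
Proof. by rewrite /qform mul_scalar_mx dotZr. Qed.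

Lemma qformZ A t x : qform A (t *: x) = t ^+ 2 * qform A x.
Proof. by rewrite /qform -scalemxAr !dotlin mulrA. Qed.

Lemma qform_line A x y t : A^T = A ->
  qform A (x + t *: y) = qform A x + 2 * t * dot y (A *m x) + t ^+ 2 * qform A y.
Proof.
move=> sA; rewrite /qform mulmxDr -scalemxAr !dotlin (dot_sym x y sA); ring.
Qed.

Lemma loewner_le0 A x : loewner_le 0 A -> 0 <= qform A x.
Proof. by move=> /(_ x); rewrite {1}/qform mul0mx /dot mulmx0 mxE. Qed.

(** The quadratic [t |-> qform A (x + t y)] has no sign change, so its
    discriminant is nonpositive. *)
Lemma cauchy_schwarz A x y : nonneg_definite A ->
  dot y (A *m x) ^+ 2 <= qform A x * qform A y.
Proof.
move=> [sA pA].
have q0 t : 0 <= qform A x + 2 * t * dot y (A *m x) + t ^+ 2 * qform A y.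
  by rewrite -qform_line//; exact: loewner_le0.
have := loewner_le0 x pA; have := loewner_le0 y pA.
move: q0; set b := dot _ _; set a := qform A y; set c := qform A x => q0 a0 c0.
have [a_eq0|a_neq0] := eqVneq a 0.
  have [->|b0] := eqVneq b 0; first by rewrite a_eq0 expr0n mulr0.
  have := q0 (- (c + 1) / (2 * b)); rewrite a_eq0 mulr0 addr0.
  rewrite (_ : 2 * _ * b = - (c + 1)); last by field.
  by rewrite opprD addNKr oppr_ge0 ler10.
have {}a0 : 0 < a by rewrite lt_def a_neq0.
have := q0 (- b / a); rewrite -(pmulr_rge0 _ a0).
rewrite (_ : a * _ = c * a - b ^+ 2) ?subr_ge0//.
by field; rewrite gt_eqF.
Qed.

Lemma entry_le_norm x i : `|x i 0| <= `|x|.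
Proof.
by rewrite [leRHS]/Num.Def.normr/= mx_normrE; exact: (le_bigmax _ _ (i, 0)).
Qed.

Lemma mxentry_le_norm A i j : `|A i j| <= `|A|.
Proof.
by rewrite [leRHS]/Num.Def.normr/= mx_normrE; exact: (le_bigmax _ _ (i, j)).
Qed.

Lemma mxentryB_le_norm A B i j : `|A i j - B i j| <= `|A - B|.
Proof. by have := mxentry_le_norm (A - B) i j; rewrite !mxE. Qed.

Lemma norm_le_dot x : `|x| ^+ 2 <= dot x x.
Proof.
rewrite -(sqr_sqrtr (dot_ge0 x)) lerXn2r ?nnegrE ?sqrtr_ge0//.
rewrite [leLHS]/Num.Def.normr/= mx_normrE bigmax_le ?sqrtr_ge0// => -[i j] _ /=.
by rewrite ord1 -sqrtr_sqr ler_sqrt ?dot_ge0// sqr_entry_le_dot.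
Qed.

Lemma dot_le_norms x y : `|dot x y| <= N%:R * (`|x| * `|y|).
Proof.
rewrite dotE (le_trans (ler_norm_sum _ _ _))//.
rewrite (le_trans (ler_sum _ (G := fun=> `|x| * `|y|) _))//.
  by move=> i _; rewrite normrM ler_pM// entry_le_norm.
by rewrite sumr_const card_ord mulr_natl.
Qed.

Lemma qform_le_norm A x : `|qform A x| <= N%:R * `|A| * dot x x.
Proof.
rewrite /qform dotE (le_trans (ler_norm_sum _ _ _))//.
pose G i := \sum_j (`|A| * 2^-1 * x i 0 ^+ 2 + `|A| * 2^-1 * x j 0 ^+ 2).
rewrite (le_trans (ler_sum _ (G := G) _))//.
  move=> i _; rewrite mxE mulr_sumr (le_trans (ler_norm_sum _ _ _))//.
  apply: ler_sum => j _; rewrite !normrM.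
  have := mxentry_le_norm A i j; have := normr_ge0 (A i j).
  rewrite -(real_normK (num_real (x i 0))) -(real_normK (num_real (x j 0))).
  move: `|x i 0| `|x j 0| (normr_ge0 (x i 0)) (normr_ge0 (x j 0)) => u v u0 v0.
  move: `|A i j| `|A| => a b a0 ab.
  rewrite mulrCA (@le_trans _ _ (b * (u * v)))//.
    by rewrite ler_wpM2r ?mulr_ge0.
  rewrite -mulrDr -mulrA ler_wpM2l ?(le_trans a0)//.
  rewrite ler_pdivlMl// -subr_ge0.
  by rewrite (_ : _ - _ = (u - v) ^+ 2) ?sqr_ge0//; ring.
rewrite le_eqVlt; apply/orP; left; apply/eqP; rewrite /G.
under eq_bigr do rewrite big_split/= sumr_const card_ord -mulr_sumr.
rewrite big_split/= sumr_const card_ord.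
rewrite sumrMnl -mulr_sumr -[X in X + _]mulr_natl -[X in _ + X]mulr_natl dotE.
rewrite (eq_bigr (fun i => x i 0 ^+ 2)) => [|i _]; last by rewrite expr2.
by move: (\sum_i _) => s; field.
Qed.

End Dot.

(** * Extreme eigenvalues and square roots *)

Section Rayleigh.
Context {K : realType} {N : nat}.
Implicit Types (x y : 'cV[K]_N) (A S : 'M[K]_N) (a : K).

(** Cauchy-Schwarz between [x] and [P^-1 x] gives
    [(dot x x)^2 <= qform P x * qform P (P^-1 x)], and the last factor, which is
    [qform P^-1 x], is at most a constant times [dot x x]. *)
Lemma nonneg_unitmx_coercive (P : 'M[K]_N) : nonneg_definite P ->
  P \in unitmx -> exists2 c, 0 < c & forall x, c * dot x x <= qform P x.
Proof.
move=> nP uP; pose C := 1 + N%:R * `|invmx P|.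
have C0 : 0 < C by rewrite ltr_pwDl// mulr_ge0.
exists C^-1 => [|x]; first by rewrite invr_gt0.
have [->|x0] := eqVneq x 0; first by rewrite qform0 /dot mulmx0 mxE mulr0.
have := cauchy_schwarz x (invmx P *m x) nP.
have -> : dot (invmx P *m x) (P *m x) = dot x x.
  by rewrite dot_sym ?nP.1// mulmxA mulmxV// mul1mx.
have -> : qform P (invmx P *m x) = qform (invmx P) x.
  by rewrite /qform mulmxA mulmxV// mul1mx dotC.
have xx := dot_gt0 x0; have /ler_normlP[_] := qform_le_norm (invmx P) x.
move=> Px; have q0 := loewner_le0 x nP.2 => qq.
rewrite ler_pdivrMl// -(ler_pM2l xx) -expr2 (le_trans qq)//.
rewrite [leRHS]mulrA [leRHS]mulrC ler_wpM2l// (le_trans Px)// mulrC.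
by rewrite ler_wpM2l ?dot_ge0// lerDr.
Qed.

(** The least upper bound [l] of the Rayleigh quotient is an eigenvalue:
    otherwise [l - A] is nonnegative definite and invertible, hence coercive,
    and [l] could be decreased. *)
Lemma max_eigenvalue_qform A a x : A^T = A -> is_max_eigenvalue A a ->
  qform A x <= a * dot x x.
Proof.
move=> sA [/eigenvalueP[v0 v0A v0_neq0] amax].
pose E := [set c | forall y, qform A y <= c * dot y y].
have v0T : v0^T != 0 by rewrite -trmx0 (inj_eq trmx_inj).
have infE : has_inf E; first split.
  exists (N%:R * `|A|) => y.
  by have /ler_normlP[] := qform_le_norm A y.
  exists a => c /(_ v0^T); rewrite /qform -{1}sA -trmx_mul v0A linearZ/= dotZr.
  by rewrite ler_pM2r// dot_gt0.
pose l := inf E.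
have El : E l.
  move=> y; have [->|y0] := eqVneq y 0.
    by rewrite qform0 /dot mulmx0 mxE mulr0.
  rewrite -ler_pdivrMr ?dot_gt0//; apply: lb_le_inf; first exact: infE.1.
  by move=> c Ec; rewrite ler_pdivrMr ?dot_gt0//; exact: Ec.
suff la : eigenvalue A l.
  by rewrite (le_trans (El x))// ler_wpM2r ?dot_ge0// amax.
rewrite /eigenvalue /eigenspace kermx_eq0 row_free_unit; apply/negP => uP.
have nP : nonneg_definite (l%:M - A).
  split; first by rewrite linearB/= tr_scalar_mx sA.
  move=> y; rewrite {1}/qform mul0mx {1}/dot mulmx0 mxE.
  by rewrite qformD qformN qform_scalar subr_ge0; exact: El.
have {uP}uP : l%:M - A \in unitmx by rewrite -opprB -scaleN1r unitmxZ// unitrN1.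
have [c c0 cP] := nonneg_unitmx_coercive nP uP.
have : E (l - c).
  by move=> y; have := cP y; rewrite qformD qformN qform_scalar; lra.
by move=> /(ge_inf infE.2); rewrite -/l; lra.
Qed.

Lemma min_eigenvalue_qform A a x : A^T = A -> is_min_eigenvalue A a ->
  a * dot x x <= qform A x.
Proof.
move=> sA [ea amin].
have eN (C : 'M[K]_N) b : eigenvalue C b -> eigenvalue (- C) (- b).
  move=> /eigenvalueP[v vC v0]; apply/eigenvalueP; exists v => //.
  by rewrite mulmxN vC scaleNr.
have maxN : is_max_eigenvalue (- A) (- a).
  split=> [|b eb]; first exact: eN.
  by rewrite lerNr; apply: amin; rewrite -[A]opprK; exact: eN.
have := @max_eigenvalue_qform (- A) _ x _ maxN.
by rewrite linearN/= sA qformN mulNr lerN2; apply.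
Qed.

Lemma eigenvalue_qform A a : A^T = A -> eigenvalue A a ->
  exists2 x, x != 0 & qform A x = a * dot x x.
Proof.
move=> sA /eigenvalueP[v vA v0]; exists v^T.
  by rewrite -trmx0 (inj_eq trmx_inj).
by rewrite /qform -{1}sA -trmx_mul vA linearZ/= dotZr.
Qed.

Lemma pos_definite_unitmx A : pos_definite A -> A \in unitmx.
Proof.
move=> [sA pA]; rewrite -row_free_unit -kermx_eq0; apply/negPn/negP => k0.
have : eigenvalue A 0 by rewrite /eigenvalue /eigenspace raddf0 subr0.
move=> /(eigenvalue_qform sA)[x x0]; rewrite mul0r => qx.
by have := pA x x0; rewrite qx {1}/qform mul0mx /dot mulmx0 mxE ltxx.
Qed.

End Rayleigh.

Section SquareRoot.
Context {K : realType}.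

Lemma interpolation (f : K -> K) (s : seq K) :
  exists p : {poly K}, forall x, x \in s -> p.[x] = f x.
Proof.
elim: s => [|a s [p ps]]; first by exists 0.
have [as_|as_] := boolP (a \in s).
  by exists p => x; rewrite inE => /predU1P[->|]; exact: ps.
pose q := \prod_(b <- s) ('X - b%:P).
have qa : q.[a] != 0 by move: as_; rewrite -root_prod_XsubC.
exists (p + ((f a - p.[a]) / q.[a]) *: q) => x; rewrite inE.
move=> /predU1P[->|xs]; rewrite hornerD hornerZ; first by rewrite divfK// subrKC.
suff /eqP -> : q.[x] == 0 by rewrite mulr0 addr0 ps.
by rewrite -[_ == 0]/(root q x) root_prod_XsubC.
Qed.

Lemma trmx_horner_mx n (A : 'M[K]_n.+1) (p : {poly K}) :
  A^T = A -> (horner_mx A p)^T = horner_mx A p.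
Proof.
move=> sA; elim/poly_ind: p => [|p c IH]; first by rewrite !raddf0.
rewrite rmorphD rmorphM/= horner_mx_X horner_mx_C linearD/= tr_scalar_mx.
by rewrite -mulmxE trmx_mul IH sA comm_mx_horner.
Qed.

(** Over the complex numbers [A] is unitarily diagonalizable with nonnegative
    eigenvalues. A real polynomial [p] mapping each eigenvalue to its fourth
    root gives a symmetric [p(A)] with [p(A)^4 = A], and [p(A)^2] is a
    nonnegative definite square root of [A]. *)
Lemma nonneg_sqrt_exists n (A : 'M[K]_n) : nonneg_definite A ->
  exists S, nonneg_definite S /\ S *m S = A.
Proof.
case: n A => [|n] A [sA pA].
  by exists A; split=> //; apply/matrixP => -[].
pose C : numClosedFieldType := K[i]%C.
pose toC : {rmorphism K -> C} := real_complex K.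
pose Ac := map_mx toC A.
have Aherm : Ac \is hermsymmx.
  apply: realsym_hermsym.
    rewrite qualifE expr0 scale1r; apply/eqP/matrixP => i j.
    by rewrite !mxE/= -{1}sA mxE.
  by apply/mxOverP => i j; rewrite mxE; apply/complex_realP; exists (A i j).
have dreal := hermitian_spectral_diag_real Aherm.
have /hermitian_normalmx/orthomx_spectralP := Aherm.
move: dreal; have := spectral_unit Ac.
move: (spectralmx Ac) (spectral_diag Ac) => P d uP /mxOverP dreal AE.
pose e j : K := complex.Re (d 0 j : K[i]%C).
have de j : d 0 j = toC (e j).
  by have /complex_realP[r dr] := dreal 0 j; rewrite /e dr.
have e_ge0 j : 0 <= e j.
  have : eigenvalue Ac (toC (e j)).
    apply/eigenvalueP; exists (row j P).
      rewrite -row_mul {1}AE !mulmxA mulmxV// mul1mx row_mul row_diag_mx.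
      by rewrite -scalemxAl -rowE de.
    apply/negP => /eqP r0; have : delta_mx 0 j *m P = 0 :> 'rV_n.+1.
      by rewrite -rowE.
    move=> /(congr1 (fun M => M *m invmx P)); rewrite mul0mx mulmxK//.
    by move=> /matrixP/(_ 0 j)/eqP; rewrite !mxE !eqxx oner_eq0.
  rewrite eigenvalue_root_char -map_char_poly fmorph_root -eigenvalue_root_char.
  move=> /(eigenvalue_qform sA)[x x0 qx].
  by rewrite -(pmulr_lge0 _ (dot_gt0 x0)) -qx; exact: loewner_le0.
have [p pE] := interpolation (fun x => Num.sqrt (Num.sqrt x)) [seq e j | j : 'I_n.+1].
pose T := horner_mx A p.
have sT : T^T = T by exact: trmx_horner_mx.
exists (T *m T); split.
  split=> [|x]; first by rewrite trmx_mul sT.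
  rewrite {1}/qform mul0mx {1}/dot mulmx0 mxE /qform -mulmxA dot_tr sT.
  exact: dot_ge0.
suff : horner_mx A (p ^+ 4) = A by rewrite rmorphXn/= !exprS expr0 mulr1 -!mulmxE !mulmxA.
apply: (@map_mx_inj _ _ toC); rewrite map_horner_mx -/Ac AE.
rewrite (horner_mx_uconjC _ _ uP).
rewrite horner_mx_diag.
have -> : map_mx (horner (map_poly toC (p ^+ 4))) d = d.
  apply/rowP => j; rewrite mxE de horner_map/= horner_exp pE; last first.
    by apply/mapP; exists j; rewrite ?mem_enum.
  by rewrite (exprM _ 2 2) !sqr_sqrtr ?sqrtr_ge0// e_ge0.
by [].
Qed.

Lemma mxsqrtP n (A : 'M[K]_n) : nonneg_definite A ->
  nonneg_definite (mxsqrt A) /\ mxsqrt A *m mxsqrt A = A.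
Proof.
move=> /nonneg_sqrt_exists[S SA].
by have := @xgetPex _ 0 [set S | nonneg_definite S /\ S *m S = A]; apply; exists S.
Qed.

End SquareRoot.

(** * Kantorovich's inequality and the condition number *)

Section QuadraticInequalities.
Context {K : realType} {N : nat}.
Implicit Types (x y w g d : 'cV[K]_N) (A H S : 'M[K]_N) (a b c m M : K).

Lemma nonneg_definite1 : nonneg_definite (1%:M : 'M[K]_N).
Proof.
split; first by rewrite tr_scalar_mx.
by move=> x; rewrite qform_scalar mul1r /qform mul0mx {1}/dot mulmx0 mxE dot_ge0.
Qed.

Lemma dot_cauchy_schwarz x y : dot x y ^+ 2 <= dot x x * dot y y.
Proof.
have := cauchy_schwarz y x nonneg_definite1.
by rewrite !qform_scalar !mul1r mul1mx mulrC.
Qed.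

(** With [P = M - A], which satisfies [0 <= P <= M - m], Cauchy-Schwarz for
    [P] gives [P^2 <= (M - m) P], that is [(M - A) (A - m) >= 0]; what remains
    is the inequality between the arithmetic and geometric means. *)
Lemma kantorovich A m M w : A^T = A -> 0 < m -> m <= M ->
  (forall x, m * dot x x <= qform A x) -> (forall x, qform A x <= M * dot x x) ->
  4 * (m * M) * (dot (A *m w) (A *m w) * dot w w) <= (m + M) ^+ 2 * qform A w ^+ 2.
Proof.
move=> sA m0 mM Am AM.
pose P := M%:M - A.
have PE x : qform P x = M * dot x x - qform A x.
  by rewrite qformD qformN qform_scalar.
have nP : nonneg_definite P.
  split; first by rewrite linearB/= tr_scalar_mx sA.
  move=> x; rewrite PE /qform mul0mx {1}/dot mulmx0 mxE subr_ge0; exact: AM.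
have PP : dot (P *m w) (P *m w) <= (M - m) * qform P w.
  have := cauchy_schwarz w (P *m w) nP.
  have : qform P (P *m w) <= (M - m) * dot (P *m w) (P *m w).
    by rewrite PE; have := Am (P *m w); lra.
  move: (dot_ge0 (P *m w)) (loewner_le0 w nP.2).
  move: (qform P (P *m w)) (dot _ _) (qform P w) => r e q e0 q0 rce eqr.
  have [->|e_neq0] := eqVneq e 0; first by rewrite mulr_ge0// subr_ge0.
  have {e_neq0}e_gt0 : 0 < e by rewrite lt_def e_neq0.
  rewrite -(ler_pM2l e_gt0) -expr2 (le_trans eqr)//.
  by rewrite (_ : e * _ = q * ((M - m) * e)) ?ler_wpM2l//; ring.
have : dot (A *m w) (A *m w) + m * M * dot w w <= (m + M) * qform A w.
  move: PP; rewrite PE /P mulmxBl mul_scalar_mx !dotlin (dotC (A *m w) w).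
  by rewrite -/(qform A w); lra.
have : 0 <= m * M * dot w w.
  by rewrite !mulr_ge0 ?dot_ge0// ?(le_trans (ltW m0) mM)// ltW.
move: (dot_ge0 (A *m w)); rewrite -exprMn.
rewrite (_ : 4 * _ * _ = 4 * (dot (A *m w) (A *m w) * (m * M * dot w w))); last by ring.
move: (dot _ _) (m * M * _) (_ * qform _ _) => u v s u0 v0 uvs.
rewrite (@le_trans _ _ ((u + v) ^+ 2))//.
  by rewrite -subr_ge0 (_ : _ - _ = (u - v) ^+ 2) ?sqr_ge0//; ring.
by rewrite lerXn2r// nnegrE ?addr_ge0// (le_trans _ uvs)// addr_ge0.
Qed.

Lemma qform_invmx_le H m x : pos_definite H -> 0 < m ->
  (forall y, m * dot y y <= qform H y) -> m * qform (invmx H) x <= dot x x.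
Proof.
move=> pH m0 Hm; have uH := pos_definite_unitmx pH.
pose z := invmx H *m x; have xE : x = H *m z by rewrite mulmxA mulmxV// mul1mx.
have -> : qform (invmx H) x = qform H z by rewrite /qform -xE dotC.
have := dot_cauchy_schwarz z x; rewrite {1}xE -/(qform H z).
have := Hm z; have := dot_ge0 z; have := dot_ge0 x.
move: (qform H z) (dot z z) (dot x x) => q a b b0 a0 aq qab.
have [q0|q0] := leP q 0; first by rewrite (le_trans _ b0)// pmulr_rle0.
rewrite -(ler_pM2l q0); nra.
Qed.

(** The right-hand side minus the left-hand side is
    [qform H (c d + H^-1 g) / (2 c)]. *)
Lemma newton_decrement H g d c : pos_definite H -> 0 < c ->
  - (2 * c)^-1 * qform (invmx H) g <= dot g d + 2^-1 * c * qform H d.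
Proof.
move=> pH c0; have uH := pos_definite_unitmx pH.
have : 0 <= qform H (invmx H *m g + c *: d).
  have [->|n0] := eqVneq (invmx H *m g + c *: d) 0; first by rewrite qform0.
  have := pH.2 _ n0; rewrite {1}/qform mul0mx {1}/dot mulmx0 mxE; exact: ltW.
rewrite qform_line ?pH.1// mulmxA mulmxV// mul1mx (dotC d).
have -> : qform H (invmx H *m g) = qform (invmx H) g.
  by rewrite /qform mulmxA mulmxV// mul1mx dotC.
move: (qform _ g) (dot g d) (qform H d) => p q r pqr.
rewrite mulNr lerNl -subr_ge0.
rewrite (_ : _ - _ = (2 * c)^-1 * (p + 2 * c * q + c ^+ 2 * r)).
  by rewrite mulr_ge0// invr_ge0 mulr_ge0 ?ltW.
by field; rewrite gt_eqF.
Qed.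

Section Preconditioned.
Variables (A H : 'M[K]_N) (kappa : K).
Hypotheses (A_pd : pos_definite A) (H_pd : pos_definite H).
Hypothesis kappaP : is_max_eigenvalue (mxsqrt A *m invmx H *m mxsqrt A) kappa.

Let A_nnd : nonneg_definite A.
Proof.
split=> [|x]; first exact: A_pd.1.
have [->|x0] := eqVneq x 0; first by rewrite !qform0.
exact: ltW (A_pd.2 x x0).
Qed.

Let S := mxsqrt A.
Let S_sym : S^T = S. Proof. by have [[]] := mxsqrtP A_nnd. Qed.
Let SS : S *m S = A. Proof. by have [] := mxsqrtP A_nnd. Qed.

Let S_unit : S \in unitmx.
Proof.
by have := pos_definite_unitmx A_pd; rewrite -SS unitmx_mul => /andP[].
Qed.

Let invH_sym : (invmx H)^T = invmx H.
Proof. by rewrite trmx_inv H_pd.1. Qed.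

Let SHS_qform x : qform (S *m invmx H *m S) x = qform (invmx H) (S *m x).
Proof. by rewrite /qform -!mulmxA dot_tr S_sym. Qed.

Let SHS_sym : (S *m invmx H *m S)^T = S *m invmx H *m S.
Proof. by rewrite !trmx_mul S_sym invH_sym mulmxA. Qed.

(** At an eigenvector [x], [kappa * dot x x = qform H^-1 (S x)], which is at most
    [dot (S x) (S x) / m = qform A x / m]. *)
Lemma condition_number_le m M : 0 < m ->
  (forall x, m * dot x x <= qform H x) -> (forall x, qform A x <= M * dot x x) ->
  kappa <= M / m.
Proof.
move=> m0 Hm AM; have [x x0 qx] := eigenvalue_qform SHS_sym kappaP.1.
rewrite ler_pdivlMr// -(ler_pM2r (dot_gt0 x0)) (le_trans _ (AM x))//.
have := qform_invmx_le (S *m x) H_pd m0 Hm.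
rewrite -SHS_qform qx dot_tr S_sym mulmxA SS -/(qform A x) (dotC _ x) -/(qform A x).
by rewrite mulrA (mulrC m).
Qed.

(** With [g = S w], Rayleigh's bound for [kappa] compares [g^T H^-1 g] with
    [w^T w = g^T A^-1 g], which Kantorovich's inequality compares with
    [(g^T g)^2 / g^T A g]. *)
Lemma preconditioned_kantorovich m M kappa_max g : 0 < m -> m <= M ->
  kappa <= kappa_max -> 0 <= kappa_max ->
  (forall x, m * dot x x <= qform A x) -> (forall x, qform A x <= M * dot x x) ->
  4 * (m * M) * (qform A g * qform (invmx H) g)
    <= kappa_max * (m + M) ^+ 2 * dot g g ^+ 2.
Proof.
move=> m0 mM kle k0 Am AM; pose w := invmx S *m g.
have gE : g = S *m w by rewrite mulmxA mulmxV// mul1mx.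
have gg : dot g g = qform A w.
  by rewrite gE dot_tr S_sym mulmxA SS dotC.
have Ag : qform A g = dot (A *m w) (A *m w).
  rewrite /qform gE -{1}SS -mulmxA dot_tr S_sym (mulmxA S S w) SS.
  by rewrite -{1}SS -!mulmxA (mulmxA S S w) SS.
have := kantorovich w A_pd.1 m0 mM Am AM; rewrite -gg -Ag.
have : qform (invmx H) g <= kappa_max * dot w w.
  rewrite {1}gE -SHS_qform.
  rewrite (le_trans (max_eigenvalue_qform _ SHS_sym kappaP))//.
  by rewrite ler_wpM2r ?dot_ge0.
have : 0 <= qform A g by rewrite Ag dot_ge0.
have mM0 : 0 <= 4 * (m * M) by rewrite !mulr_ge0// ?(le_trans (ltW m0) mM)// ltW.
move: (qform A g) (qform (invmx H) g) (dot w w) => a b e a0 be kant.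
rewrite (@le_trans _ _ (4 * (m * M) * (a * (kappa_max * e))))//.
  by rewrite ler_wpM2l// ler_wpM2l.
rewrite [leLHS](_ : _ = kappa_max * (4 * (m * M) * (a * e))); last by ring.
by rewrite -[leRHS]mulrA ler_wpM2l.
Qed.

End Preconditioned.
End QuadraticInequalities.

(** * Directional derivatives, Taylor's formula, convexity *)

Section DirectionalDerivatives.
Context {K : realType} {N : nat}.
Local Notation E := 'cV[K]_N.
Implicit Types (f : E -> K) (x y u v d : E) (t c : K).

Lemma vec_sum_delta v : v = \sum_j v j 0 *: delta_mx j 0.
Proof.
apply/matrixP => i k; rewrite ord1 summxE (bigD1 i)//= big1 => [|j ji].
  by rewrite !mxE !eqxx mulr1 addr0.
by rewrite !mxE eq_sym (negbTE ji) mulr0.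
Qed.

Lemma is_derive_gradient f x v : differentiable f x ->
  is_derive x v f (dot (gradient f x) v).
Proof.
move=> df; apply: DeriveDef; first exact: diff_derivable.
rewrite deriveE// {1}(vec_sum_delta v) linear_sum dotE/=.
apply: eq_bigr => j _; rewrite linearZ/= mxE -deriveE//.
exact: mulrC.
Qed.

Lemma is_derive_hessian f x v i : differentiable (gradient f) x ->
  is_derive x v (fun y => gradient f y i 0) ((hessian f x *m v) i 0).
Proof.
move=> dG; have der w : derivable (gradient f) x w by exact: diff_derivable.
have entry w : 'D_w (fun y => gradient f y i 0) x = 'D_w (gradient f) x i 0.
  by rewrite derive_mx// mxE.
apply: DeriveDef; first by have /derivable_mxP := der v.
rewrite entry deriveE// {1}(vec_sum_delta v) linear_sum summxE mxE/=.
apply: eq_bigr => j _; rewrite linearZ/= mxE -deriveE// -entry [in RHS]mxE.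
exact: mulrC.
Qed.

Lemma is_derive_dot_gradient f x u v : differentiable (gradient f) x ->
  is_derive x v (fun y => dot (gradient f y) u) (dot (hessian f x *m v) u).
Proof.
move=> dG; rewrite [X in is_derive _ _ X _](_ : _ =
    \sum_i (u i 0 *: (fun y => gradient f y i 0 : K))); last first.
  by apply/funext => y; rewrite fct_sumE dotE; apply: eq_bigr => i _; exact: mulrC.
apply: is_derive_eq.
  by apply: is_derive_sum => i; apply: is_deriveZ; exact: is_derive_hessian.
by rewrite dotE; apply: eq_bigr => i _; exact: mulrC.
Qed.

Lemma is_derive_line f x v t df :
  is_derive (x + t *: v) v f df -> is_derive t 1 (fun s => f (x + s *: v)) df.
Proof.
have E1 : (fun h => h^-1 *: (((fun s => f (x + s *: v)) \o shift t) (h *: 1) -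
    f (x + t *: v))) =
  (fun h => h^-1 *: ((f \o shift (x + t *: v)) (h *: v) - f (x + t *: v))).
  apply/funext => h /=; congr (_ *: (f _ - _)).
  by rewrite [h *: 1]mulr1 scalerDl addrCA.
by case=> cf vf; apply: DeriveDef; rewrite /derivable /derive E1.
Qed.

Lemma is_derive_translate f x u v df :
  is_derive (x + v) u f df -> is_derive x u (fun y => f (y + v)) df.
Proof.
have E1 : (fun h => h^-1 *: (((fun y => f (y + v)) \o shift x) (h *: u) -
    f (x + v))) =
  (fun h => h^-1 *: ((f \o shift (x + v)) (h *: u) - f (x + v))).
  by apply/funext => h /=; congr (_ *: (f _ - _)); rewrite addrA.
by case=> cf vf; apply: DeriveDef; rewrite /derivable /derive E1.
Qed.

Lemma mean_value_line f x v (df : E -> K) :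
  (forall y, is_derive y v f (df y)) ->
  exists2 t, 0 <= t <= 1 & f (x + v) - f x = df (x + t *: v).
Proof.
move=> fdf; pose g (t : K) := f (x + t *: v).
have gdf t : is_derive t 1 g (df (x + t *: v)) by apply: is_derive_line.
have [t t01 /=] := @MVT_segment _ g (fun t => df (x + t *: v)) 0 1 ler01
  (fun t _ => gdf t) (derivable_within_continuous (fun t _ => @ex_derive _ _ _ _ _ _ _ (gdf t))).
rewrite /g scale1r scale0r addr0 subr0 mulr1 => fE.
by exists t => //; move: t01; rewrite in_itv.
Qed.

Lemma derive_right_le f x v c : derivable f x v ->
  (forall h, 0 < h <= 1 -> f (x + h *: v) - f x <= h * c) -> 'D_v f x <= c.
Proof.
move=> dfv fc; rewrite /derive cvg_at_rightE//.
apply: limr_le; first by apply: cvgP; apply: cvg_dnbhs_at_right; exact: dfv.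
near=> h; have h0 : 0 < h by near: h; exact: nbhs_right_gt.
rewrite [leLHS](_ : _ = h^-1 * (f (x + h *: v) - f x)); last by rewrite (addrC x).
rewrite ler_pdivrMl// fc// h0/=; near: h; exact: nbhs_right_le.
Unshelve. all: by end_near. Qed.

(** The second derivative of [t |-> f (x + t v)] is at least [c], so the
    derivative of [f (x + t v) - t * dot (gradient f x) v - c t^2 / 2] is
    nonnegative. *)
Lemma taylor2_lower f x v c : twice_continuously_differentiable f ->
  (forall t, 0 <= t <= 1 -> c <= qform (hessian f (x + t *: v)) v) ->
  f x + dot (gradient f x) v + 2^-1 * c <= f (x + v).
Proof.
move=> [df dG _] cH.
pose D (t : K) := dot (gradient f (x + t *: v)) v.
have dD t : is_derive t 1 D (qform (hessian f (x + t *: v)) v).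
  by rewrite /qform dotC; exact: (is_derive_line (is_derive_dot_gradient v v (dG _))).
have D_ge t : 0 <= t <= 1 -> D 0 + c * t <= D t.
  move=> /andP[t0 t1].
  have [s] := MVT_segment t0 (fun s _ => dD s) (derivable_within_continuous
    (fun s _ => @ex_derive _ _ _ _ _ _ _ (dD s))).
  rewrite subr0 in_itv/= => /andP[s0 st] DE.
  rewrite -lerBrDl DE ler_wpM2r// cH// s0/=; exact: le_trans t1.
pose g (t : K) := f (x + t *: v) - (D 0 * t + 2^-1 * c * t ^+ 2).
have dg t : is_derive t 1 g (D t - (D 0 + c * t)).
  have h1 : is_derive t 1 (fun s => f (x + s *: v)) (D t).
    exact: (is_derive_line (is_derive_gradient v (df _))).
  have h2 : is_derive t 1 (fun s => D 0 * s + 2^-1 * c * s ^+ 2) (D 0 + c * t).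
    apply: is_derive_eq; rewrite /GRing.scale/=; by field.
  exact: is_deriveB.
have [t] := MVT_segment (@ler01 K) (fun t _ => dg t) (derivable_within_continuous
  (fun t _ => @ex_derive _ _ _ _ _ _ _ (dg t))).
rewrite subr0 in_itv/= mulr1 => t01 gE.
have : 0 <= g 1 - g 0 by rewrite gE subr_ge0 D_ge.
rewrite /g /D !scale0r !scale1r !addr0 expr1n expr0n !mulr0 !mulr1 /=.
lra.
Qed.

(** The left-hand side is symmetric in [u] and [v], while the mean value theorem,
    used along [u] and then along [v], yields the Hessian with its two arguments
    in a definite order. *)
Lemma second_difference f x u v : twice_continuously_differentiable f ->
  exists a b, [/\ 0 <= a <= 1, 0 <= b <= 1 &
    f (x + u + v) - f (x + u) - f (x + v) + f x =
    dot (hessian f (x + a *: u + b *: v) *m v) u].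
Proof.
move=> [df dG _]; pose k y := f (y + v) - f y.
have dk y : is_derive y u k (dot (gradient f (y + v)) u - dot (gradient f y) u).
  apply: is_deriveB; last exact: is_derive_gradient.
  exact: is_derive_translate (is_derive_gradient u (df _)).
have [a a01 ka] := mean_value_line x dk.
have [b b01 kb] := mean_value_line (x + a *: u)
  (fun y => is_derive_dot_gradient u v (dG y)).
exists a, b; split=> //; rewrite -kb -ka /k; lra.
Qed.

Lemma continuous_hessian_dist f x e : twice_continuously_differentiable f ->
  0 < e -> exists2 r, 0 < r &
    forall y, `|y - x| < r -> `|hessian f y - hessian f x| < e.
Proof.
move=> [_ _ /(_ x)/cvgrPdist_lt/(_ e) + e0] => /(_ e0)/nbhs_normP[r r0 rH].
exists r => // y yx; rewrite distrC; apply: rH; by rewrite /ball_/= distrC.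
Qed.

(** The two orders of evaluation of the second difference along [s e_i] and
    [s e_j] equate the entries [(i, j)] and [(j, i)] of the Hessian at two points
    that tend to [x] with [s]. *)
Lemma hessian_sym f x : twice_continuously_differentiable f ->
  (hessian f x)^T = hessian f x.
Proof.
move=> f2; apply/matrixP => i j; rewrite [LHS]mxE.
apply/eqP; rewrite -subr_eq0 -normr_le0; apply/ler_addgt0Pr => e e0; rewrite add0r.
have [r r0 rH] := continuous_hessian_dist x f2 (divr_gt0 e0 (ltr0Sn _ 1)).
(* The scale [s = r / M] keeps both second differences in the ball of radius
   [r]; the summand 1 makes the bound strict. *)
pose M : K := `|delta_mx i 0 : E| + `|delta_mx j 0 : E| + 1.
have M0 : 0 < M by rewrite ltr_wpDl// addr_ge0.
have [s s0 sM] : exists2 s : K, 0 < s & s * M = r.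
  by exists (r / M); rewrite ?divr_gt0// divfK// gt_eqF.
pose u : E := s *: delta_mx i 0; pose v : E := s *: delta_mx j 0.
have uv_small : `|u| + `|v| < r.
  by rewrite /u /v !normrZ (gtr0_norm s0) -mulrDr -sM ltr_pM2l// ltrDl.
have near a b (p q : E) : 0 <= a <= 1 -> 0 <= b <= 1 -> `|p| + `|q| < r ->
    `|hessian f (x + a *: p + b *: q) - hessian f x| < e / 2.
  move=> /andP[a0 a1] /andP[b0 b1] pq; apply: rH.
  rewrite -[x + _ + _]addrA (addrC x) addrK (le_lt_trans _ pq)//.
  rewrite (le_trans (ler_normD _ _))// !normrZ !ger0_norm// lerD//.
    by rewrite ler_piMl.
  by rewrite ler_piMl.
have [a [b [a01 b01 +]]] := second_difference x u v f2.
have [a' [b' [a01' b01' +]]] := second_difference x v u f2.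
rewrite (addrAC x v u) (addrAC _ (- f (x + v))) => ->.
have dotH (H : 'M[K]_N) k l : dot (H *m (s *: delta_mx k 0)) (s *: delta_mx l 0) =
    s ^+ 2 * H l k.
  by rewrite -scalemxAr !dotlin mulrA dotC dot_delta -colE mxE.
have s2 : s ^+ 2 != 0 by rewrite expf_neq0// gt_eqF.
have vu_small : `|v| + `|u| < r by rewrite addrC.
move: (near _ _ u v a01 b01 uv_small) (near _ _ v u a01' b01' vu_small).
move: (hessian f (x + _ + _)) (hessian f (x + _ + _)) (hessian f x) => P Q H.
move=> PH QH; rewrite !dotH => /(mulfI s2) PQ.
have := le_lt_trans (mxentryB_le_norm _ _ i j) PH.
have := le_lt_trans (mxentryB_le_norm _ _ j i) QH; rewrite PQ.
move: (P i j) (H i j) (H j i) => p q q'.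
rewrite !ltr_norml ler_norml => /andP[? ?] /andP[? ?].
by apply/andP; split; lra.
Qed.

Section Convex.
Variable f : E -> K.
Hypothesis f_convex : convex_function setT f.

Lemma convex_line x d t : 0 <= t <= 1 ->
  f (x + t *: d) <= f x + t * (f (x + d) - f x).
Proof.
move=> /andP[t0 t1].
have := f_convex (Itv01 t0 t1) (in_setT (x + d)) (in_setT x).
rewrite /conv/= /conv/=.
have -> : t *: (x + d) + unstable.onem t *: x = x + t *: d.
  by rewrite /unstable.onem scalerDr scalerBl scale1r addrC addrA subrK.
rewrite /unstable.onem; move: (f _) (f (x + d)) (f x) => a b c.
by rewrite /GRing.scale/=; lra.
Qed.

Lemma convex_gradient_le x y : differentiable f x ->
  f x + dot (gradient f x) (y - x) <= f y.
Proof.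
move=> df; have dfx := is_derive_gradient (y - x) df.
rewrite -lerBrDl -(@derive_val _ _ _ _ _ _ _ dfx).
apply: derive_right_le => [|h /andP[h0 h1]]; first exact: ex_derive.
rewrite lerBlDl; have := convex_line x (y - x) (t := h).
by rewrite subrKC; apply; rewrite ltW.
Qed.

Lemma convex_gradient_monotone x y : differentiable f x -> differentiable f y ->
  dot (gradient f x) (y - x) <= dot (gradient f y) (y - x).
Proof.
move=> dfx dfy; have := convex_gradient_le y dfx; have := convex_gradient_le x dfy.
rewrite -(opprB y x) dotNr; lra.
Qed.

Lemma convex_hessian_ge0 x d : (forall y, differentiable f y) ->
  differentiable (gradient f) x -> 0 <= qform (hessian f x) d.
Proof.
move=> df dG; rewrite /qform dotC -oppr_le0.
have dD := is_derive_dot_gradient d d dG.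
have dN := is_deriveN dD; rewrite -(@derive_val _ _ _ _ _ _ _ dN).
apply: derive_right_le => [|h /andP[h0 h1]]; first exact: ex_derive.
rewrite mulr0 opprK addrC subr_le0.
have := convex_gradient_monotone (df x) (df (x + h *: d)).
by rewrite (addrC x) addrK !dotZr ler_pM2l.
Qed.

End Convex.

End DirectionalDerivatives.

(** * The cost function and strong convexity *)

Section Cost.
Context {K : realType} {N : nat}.
Variables (R : 'M[K]_N) (r : 'cV[K]_N) (Psi : 'cV[K]_N -> K).
Implicit Types x d v : 'cV[K]_N.
Hypothesis R_sym : R^T = R.
Hypothesis Psi_C2 : twice_continuously_differentiable Psi.
Local Notation F := (cost R r Psi).

Lemma cost_line x d :
  F (x + d) = F x + dot (R *m x - r) d + 2^-1 * qform R d + (Psi (x + d) - Psi x).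
Proof.
rewrite /cost -[d in qform R (x + d)]scale1r qform_line// !dotlin.
by rewrite (dotC d); field.
Qed.

Let is_derive_cost x v : is_derive x v F (dot (R *m x - r + gradient Psi x) v).
Proof.
have [dPsi _ _] := Psi_C2.
pose Q y : K := 2^-1 * qform R y - dot r y.
have -> : F = Q + Psi by apply/funext.
rewrite dotDl; apply: is_deriveD; last exact: is_derive_gradient.
have QE : \forall h \near 0^', h^-1 *: ((Q \o shift x) (h *: v) - Q x) =
    dot (R *m x - r) v + h * (2^-1 * qform R v).
  near=> h; have h0 : h != 0 by near: h; exact: nbhs_dnbhs_neq.
  rewrite /= [_ *: v + x]addrC /Q qform_line// !dotlin (dotC v).
  rewrite /GRing.scale/=; by field.
have lim : (dot (R *m x - r) v + h * (2^-1 * qform R v)) @[h --> 0^'] -->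
    dot (R *m x - r) v.
  rewrite -[X in _ --> X]addr0; apply: cvgD; first exact: cvg_cst.
  rewrite -[X in _ --> X](mul0r (2^-1 * qform R v)); apply: cvgMl.
  exact: cvg_within.
have QF : h^-1 *: ((Q \o shift x) (h *: v) - Q x) @[h --> 0^'] --> dot (R *m x - r) v.
  by apply: cvg_trans lim; apply: near_eq_cvg; near=> h; rewrite -(near QE h).
by apply: DeriveDef; [apply: cvgP QF | apply/cvg_lim].
Unshelve. all: by end_near. Qed.

Lemma gradient_cost x : gradient F x = R *m x - r + gradient Psi x.
Proof.
apply/colP => i; rewrite mxE (@derive_val _ _ _ _ _ _ _ (is_derive_cost x _)).
by rewrite dotC dot_delta.
Qed.

Lemma hessian_cost x : hessian F x = R + hessian Psi x.
Proof.
have [_ dG _] := Psi_C2.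
apply/matrixP => i j; rewrite mxE.
have -> : (fun y => gradient F y i 0) =
    (fun y => (R *m y - r) i 0) + (fun y => gradient Psi y i 0).
  by apply/funext => y; rewrite gradient_cost mxE.
have dR : is_derive x (delta_mx j 0) (fun y => (R *m y - r) i 0) (R i j).
  have E1 : \forall h \near 0^', h^-1 *: (((fun y => (R *m y - r) i 0) \o shift x)
      (h *: delta_mx j 0) - (R *m x - r) i 0) = R i j.
    near=> h; have h0 : h != 0 by near: h; exact: nbhs_dnbhs_neq.
    rewrite /= mulmxDr -scalemxAr -colE !mxE.
    by rewrite /GRing.scale/= -[R in LHS]/R; field.
  apply: DeriveDef; [exact: is_cvg_near_cst E1|exact: lim_near_cst E1].
have dP := is_derive_hessian (delta_mx j 0) i (dG x).
rewrite (@derive_val _ _ _ _ _ _ _ (is_deriveD dR dP)).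
by rewrite -colE !mxE.
Unshelve. all: by end_near. Qed.

Lemma taylor2_lower_cost x v c :
  (forall t, 0 <= t <= 1 -> c <= qform (hessian Psi (x + t *: v)) v) ->
  F x + dot (gradient F x) v + 2^-1 * (qform R v + c) <= F (x + v).
Proof.
move=> /(taylor2_lower Psi_C2); rewrite cost_line gradient_cost dotDl; lra.
Qed.

Lemma strongly_convex_cost x v : convex_function setT Psi ->
  F x + dot (gradient F x) v + 2^-1 * qform R v <= F (x + v).
Proof.
move=> cPsi; have [dPsi dG _] := Psi_C2.
rewrite -[qform R v]addr0; apply: taylor2_lower_cost => t _.
exact: convex_hessian_ge0.
Qed.

End Cost.

Section StrongConvexity.
Context {K : realType} {N : nat}.
Variables (F : 'cV[K]_N -> K) (G : 'cV[K]_N -> 'cV[K]_N) (m : K).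
Implicit Types x y d : 'cV[K]_N.
Hypothesis m_gt0 : 0 < m.
Hypothesis F_sc : forall x d, F x + dot (G x) d + 2^-1 * (m * dot d d) <= F (x + d).

Lemma strongly_convex_line x d t : 0 <= t <= 1 ->
  F (x + t *: d) + 2^-1 * m * (t * (1 - t)) * dot d d
    <= (1 - t) * F x + t * F (x + d).
Proof.
move=> /andP[t0 t1]; set z := x + t *: d.
have := F_sc z (- t *: d); have := F_sc z ((1 - t) *: d).
have -> : z + - t *: d = x by rewrite /z scaleNr addrK.
have -> : z + (1 - t) *: d = x + d by rewrite /z -addrA -scalerDl subrKC scale1r.
rewrite !dotlin; move: (F z) (dot (G z) d) (dot d d) (F x) (F (x + d)) => z0 g e a b H1 H2.
have {}H1 := ler_wpM2l t0 H1.
have {}H2 : (1 - t) * _ <= _ := ler_wpM2l (eqbRL (subr_ge0 _ _) t1) H2.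
have := lerD H1 H2; lra.
Qed.

(** The lower bound [F_sc] for [F (x + d)] is smallest at [d = - G x / m]. *)
Lemma gradient_dominates x y : F x - F y <= dot (G x) (G x) / (2 * m).
Proof.
have := F_sc x (y - x); rewrite subrKC; move: (y - x) => d.
have := dot_ge0 (m *: d + G x); rewrite !dotlin (dotC d (G x)).
move: (F x) (F y) (dot _ d) (dot d d) (dot (G x) (G x)) => a b g e s H1 H2.
rewrite ler_pdivlMr ?mulr_gt0//.
have := ler_wpM2l (ltW m_gt0) H2; lra.
Qed.

Lemma has_lbound_range : has_lbound (range F).
Proof.
exists (F 0 - dot (G 0) (G 0) / (2 * m)) => _ [y _ <-].
by rewrite lerBlDl -lerBlDr gradient_dominates.
Qed.

Lemma inf_range_le x : inf (range F) <= F x.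
Proof. by apply: ge_inf; [exact: has_lbound_range|exists x]. Qed.

Lemma gradient_dominates_inf x : F x - inf (range F) <= dot (G x) (G x) / (2 * m).
Proof.
rewrite lerBlDl -lerBlDr; apply: lb_le_inf; first by exists (F 0), 0.
by move=> _ [y _ <-]; rewrite lerBlDr -lerBlDl gradient_dominates.
Qed.

Lemma near_minimizers_close x y e :
  F x <= inf (range F) + e -> F y <= inf (range F) + e ->
  m * `|x - y| ^+ 2 <= 8 * e.
Proof.
move=> Fx Fy; have half01 : 0 <= (2^-1 : K) <= 1 by apply/andP; split; lra.
have := strongly_convex_line y (x - y) half01; rewrite subrKC.
have := inf_range_le (y + 2^-1 *: (x - y)).
have := ler_wpM2l (ltW m_gt0) (norm_le_dot (x - y)); lra.
Qed.

(** By strong convexity at midpoints, a minimizing sequence is a Cauchy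
    sequence; at its limit [x] the gradient inequality bounds [F x] by the
    limit of the values. *)
Lemma strongly_convex_minimizer : exists x, F x = inf (range F).
Proof.
have infF : has_inf (range F).
  by split; [exists (F 0), 0|exact: has_lbound_range].
have near_inf e : 0 < e -> exists x, F x < inf (range F) + e.
  by move=> e0; have [_ [x _ <-] Fx] := inf_adherent e0 infF; exists x.
pose u n : 'cV[K]_N := sval (cid (near_inf _ (divr_gt0 ltr01 (ltr0Sn K n)))).
have uE n : F (u n) < inf (range F) + 1 / n.+1%:R by rewrite /u; case: cid.
have gap0 e : 0 < e -> \forall n \near \oo, F (u n) < inf (range F) + e.
  move=> e0; near=> n; rewrite (lt_trans (uE n))// ltrD2l div1r.
  by near: n; exact: near_infty_natSinv_lt (PosNum e0).
have cu : cvg (u @ \oo).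
  apply/cauchy_cvgP/cauchy_exP => e e0.
  (* Gaps below [d] force a squared distance of at most [8 d / m < e^2]. *)
  pose d := m * e ^+ 2 / 16; have d0 : 0 < d by rewrite divr_gt0 ?mulr_gt0 ?exprn_gt0.
  have [k _ ku] := gap0 d d0; exists (u k).
  suff H : \forall n \near \oo, ball (u k) e (u n) by exact: H.
  near=> n.
  have Fk := ku k (leqnn k); have Fn : F (u n) < inf (range F) + d by near: n; exact: gap0.
  rewrite -ball_normE/= -(@ltr_pXn2r _ 2) ?nnegrE// ?ltW//.
  rewrite -(ltr_pM2l m_gt0) (le_lt_trans (near_minimizers_close (ltW Fk) (ltW Fn)))//.
  rewrite /d; have := mulr_gt0 m_gt0 (exprn_gt0 2 e0); lra.
pose x := lim (u @ \oo); exists x; apply/eqP.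
rewrite eq_le inf_range_le andbT; apply/ler_addgt0Pr => e e0.
have e2 : 0 < e / 2 by rewrite divr_gt0.
pose C := N%:R * `|G x| + 1; have C0 : 0 < C by rewrite ltr_wpDl// mulr_ge0.
near \oo => n.
have Fn : F (u n) < inf (range F) + e / 2 by near: n; exact: gap0.
have xn : `|u n - x| < e / 2 / C.
  rewrite distrC; near: n; move/cvgrPdist_lt : cu; apply.
  by rewrite divr_gt0.
have := F_sc x (u n - x); rewrite subrKC.
have /ler_normlP[+ _] := dot_le_norms (G x) (u n - x).
have : N%:R * (`|G x| * `|u n - x|) <= e / 2.
  rewrite mulrA (@le_trans _ _ (C * `|u n - x|))//.
    by rewrite ler_wpM2r// lerDl.
  by rewrite mulrC -ler_pdivlMr// ltW.
have : 0 <= m * dot (u n - x) (u n - x) by rewrite mulr_ge0 ?dot_ge0// ltW.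
lra.
Unshelve. all: by end_near. Qed.

(** Along the segment from the minimizer [x] to [y], strong convexity gives the
    bound up to the factor [1 - t], and [t] tends to [0]. *)
Lemma quadratic_growth x y : F x = inf (range F) ->
  2^-1 * m * dot (y - x) (y - x) <= F y - inf (range F).
Proof.
move=> Fx; set D := dot _ _.
have line t : 0 < t -> t <= 1 -> (1 - t) * (2^-1 * m * D) <= F y - inf (range F).
  move=> t0 t1; have t01 : 0 <= t <= 1 by rewrite ltW.
  rewrite -(ler_pM2l t0).
  have := strongly_convex_line x (y - x) t01; rewrite subrKC -/D Fx.
  have := inf_range_le (x + t *: (y - x)); 
  move: (F _) (F y) (inf _) => a b c; lra.
have [->|D_neq0] := eqVneq D 0.
  by rewrite mulr0 subr_ge0 inf_range_le.
have D0 : 0 < 2^-1 * m * D by rewrite !mulr_gt0// lt_def D_neq0 dot_ge0.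
move: D0 line (inf_range_le y); rewrite -subr_ge0.
move: (2^-1 * m * D) (F y - _) => c g c0 line g0.
rewrite leNgt; apply/negP => gc.
have gc1 : g / c < 1 by rewrite ltr_pdivrMr// mul1r.
have gc0 : 0 <= g / c by rewrite divr_ge0// ltW.
have := line ((1 - g / c) / 2); rewrite divr_gt0 ?subr_gt0//.
rewrite (_ : (1 - _) * c = (c + g) / 2); last by field; rewrite gt_eqF.
move=> /(_ isT); lra.
Qed.

End StrongConvexity.

(** * One step of the algorithm, and the gap near the minimizer *)

Section MajorizeMinimize.
Context {K : realType} {N : nat}.
Implicit Types (x y d v : 'cV[K]_N) (m M : K).

(** The steepest descent point [x - t g] belongs to the search space, which
    contains [x] and the gradient [g]. *)
Lemma mm_step_descent (F : 'cV[K]_N -> K) (A : 'cV[K]_N -> 'M[K]_N) p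
    (D : 'M[K]_(N, p)) x y t (g := gradient F x) :
  F y - F x <= majorant F A y x - majorant F A x x ->
  argmin (fun z => majorant F A z x) (ran D) y -> ran D g -> ran D x ->
  F y <= F x - t * dot g g + 2^-1 * t ^+ 2 * qform (A x) g.
Proof.
move=> maj [_ miny] [a _ aE] [b _ bE].
have : majorant F A y x <= majorant F A (x - t *: g) x.
  apply: miny; exists (b - t *: a) => //.
  by rewrite mulmxBr -scalemxAr aE bE.
move: maj; rewrite /majorant -/g (subrr x) qform0 {2}/dot mulmx0 mxE.
have -> : x - t *: g - x = - t *: g by rewrite addrAC (subrr x) add0r scaleNr.
rewrite qformZ dotZr sqrrN.
lra.
Qed.

(** Near the minimizer [z], the Hessian varies little along the segment from
    [x] to [z], relative to its lower bound [m]. Taylor's formula then bounds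
    [F z] from below by a quadratic function of [z - x] with Hessian
    [hessian F x / (1 + eps)], whose minimum is the Newton decrement. *)
Lemma near_newton_decrement (R : 'M[K]_N) r Psi m eps z :
  pos_definite R -> twice_continuously_differentiable Psi ->
  convex_function setT Psi -> 0 < m -> (forall x, m * dot x x <= qform R x) ->
  0 < eps -> let F := cost R r Psi in
  exists2 rho, 0 < rho & forall x, `|x - z| < rho ->
    F x - F z <= (1 + eps) / 2 * qform (invmx (hessian F x)) (gradient F x).
Proof.
move=> R_pd Psi_C2 Psi_convex m0 Rm eps0 F.
have [dPsi dG _] := Psi_C2.
(* The factor left to the Hessian after absorbing its variation. *)
pose c := (1 + eps)^-1; have c0 : 0 < c by rewrite invr_gt0 addr_gt0.
have c1 : 0 < 1 - c by rewrite subr_gt0 invf_lt1 ?addr_gt0// ltrDl.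
pose q : K := N%:R + 1; have q0 : 0 < q by rewrite ltr_wpDl.
(* Two points of the ball have Hessians within [2 e], which changes the
   quadratic form by at most [2 N e dot v v <= (1 - c) m dot v v]. *)
pose e := (1 - c) * m / (2 * q).
have e0 : 0 < e by rewrite divr_gt0 ?mulr_gt0.
have [rho rho0 rhoH] := continuous_hessian_dist z Psi_C2 e0.
exists rho => // x xz; set H := hessian F x; set g := gradient F x.
pose v := z - x.
have HE : H = R + hessian Psi x by exact: hessian_cost R_pd.1 Psi_C2 x.
have gE : gradient F x = g by [].
clearbody H g.
have Psi_ge0 : 0 <= qform (hessian Psi x) v by exact: convex_hessian_ge0.
have H_ge y : qform R y <= qform H y.
  by rewrite HE qformD lerDl; exact: convex_hessian_ge0.
have H_pd : pos_definite H.
  split; first by rewrite HE linearD/= R_pd.1 hessian_sym.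
  by move=> y y0; rewrite (lt_le_trans (R_pd.2 y y0)).
have near_x t : 0 <= t <= 1 -> `|hessian Psi (x + t *: v) - hessian Psi x| <= 2 * e.
  move=> /andP[t0 t1].
  have xt : `|x + t *: v - z| < rho.
    have -> : x + t *: v - z = (1 - t) *: (x - z).
      by rewrite /v scalerBl scale1r -[z - x]opprB scalerN addrAC.
    rewrite normrZ ger0_norm ?subr_ge0// (le_lt_trans _ xz)//.
    by rewrite ler_piMl// lerBlDr lerDl.
  rewrite -(subrKA (hessian Psi z)) (le_trans (ler_normD _ _))//.
  rewrite mulr_natl mulr2n; apply: lerD; first exact/ltW/rhoH.
  by rewrite distrC; exact/ltW/rhoH.
have taylor t : 0 <= t <= 1 ->
    qform (hessian Psi x) v - N%:R * (2 * e) * dot v v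
      <= qform (hessian Psi (x + t *: v)) v.
  move=> /near_x dH; rewrite lerBlDr -lerBlDl -qformN -qformD.
  have := qform_le_norm (hessian Psi x - hessian Psi (x + t *: v)) v.
  move=> /ler_normlP[_] /le_trans; apply; rewrite distrC.
  by rewrite ler_wpM2r ?dot_ge0// ler_wpM2l.
have := taylor2_lower_cost r R_pd.1 Psi_C2 taylor.
rewrite -/F gE -[x + v]addrC /v subrK -/v => Fz.
have small : N%:R * (2 * e) * dot v v <= (1 - c) * qform H v.
  rewrite (@le_trans _ _ ((1 - c) * (m * dot v v)))//; last first.
    by apply: ler_wpM2l; [exact: ltW|exact: le_trans (Rm v) (H_ge v)].
  rewrite [leRHS]mulrA ler_wpM2r ?dot_ge0// /e.
  rewrite (_ : _ * _ = (1 - c) * m * (N%:R / q)).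
    by rewrite ler_piMr ?mulr_ge0 ?ltW// ltr_pdivrMr// mul1r ltrDl.
  by field; rewrite gt_eqF.
have := newton_decrement g v H_pd c0; rewrite /c invfM invrK.
have : qform H v = qform R v + qform (hessian Psi x) v by rewrite HE qformD.
move: small Fz; rewrite -/c; move: (qform H v) (qform (invmx H) g) => a b.
lra.
Qed.

End MajorizeMinimize.

(** * Linear rate *)

Section LinearRate.
Context {K : realType} {N : nat}.
Implicit Types (g x z : 'cV[K]_N) (A H : 'M[K]_N) (m M q : K).

Lemma geometric_decay (u : nat -> K) q n0 : 0 < q ->
  (forall n, (n0 <= n)%N -> u n.+1 <= q * u n) ->
  forall n, (n0 <= n)%N -> u n <= u n0 / q ^+ n0 * q ^+ n.
Proof.
move=> q0 uq; elim=> [|n IH].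
  by rewrite leqn0 => /eqP ->; rewrite expr0 divr1 mulr1.
rewrite leq_eqVlt => /predU1P[->|n0n].
  by rewrite divfK// expf_neq0// gt_eqF.
rewrite (le_trans (uq n n0n))// exprS mulrCA ler_wpM2l ?(ltW q0)//; exact: IH.
Qed.

Lemma geometric_converges_linearly (h : nat -> 'cV[K]_N) z m C q n0 :
  0 < m -> 0 < q < 1 ->
  (forall n, (n0 <= n)%N ->
    2^-1 * m * dot (h n - z) (h n - z) <= C * q ^+ n) ->
  converges_linearly h z (Num.sqrt q).
Proof.
move=> m0 /andP[q0 q1] hC.
have C0 : 0 <= C.
  rewrite -(pmulr_lge0 _ (exprn_gt0 n0 q0)) (le_trans _ (hC n0 _))//.
  by rewrite !mulr_ge0 ?dot_ge0// ltW.
pose c := Num.sqrt (2 * C / m).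
have hc n : (n0 <= n)%N -> norm2 (h n - z) <= c * Num.sqrt q ^+ n.
  move=> /hC hn; have -> : Num.sqrt q ^+ n = Num.sqrt (q ^+ n).
    by elim: n {hn} => [|n IH]; rewrite ?expr0 ?sqrtr1// !exprS sqrtrM ?IH// ltW.
  have c_ge0 : 0 <= 2 * C / m by rewrite divr_ge0 ?mulr_ge0// ltW.
  have qn : 0 <= q ^+ n by rewrite exprn_ge0// ltW.
  rewrite /c -sqrtrM// /norm2 ler_sqrt; last by rewrite mulr_ge0.
  rewrite [leRHS]mulrAC ler_pdivlMr//; lra.
have s1 : Num.sqrt q < 1 by rewrite -sqrtr1 ltr_sqrt.
split; last 2 first.
- by rewrite sqrtr_ge0.
- by exists c; exists n0.
have to0 : c * Num.sqrt q ^+ n @[n --> \oo] --> 0.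
  rewrite -[X in _ --> X](mulr0 c); apply: cvgMr; apply: cvg_expr.
  by rewrite ger0_norm ?sqrtr_ge0.
apply/cvgrPdist_lt => e e0; near=> n.
have hn : norm2 (h n - z) <= c * Num.sqrt q ^+ n.
  by apply: hc; near: n; exact: nbhs_infty_ge.
have cn : `|0 - c * Num.sqrt q ^+ n| < e.
  by near: n; move/cvgrPdist_lt : to0; apply.
rewrite distrC (le_lt_trans _ cn)// sub0r normrN (le_trans _ (ler_norm _))//.
rewrite (le_trans _ hn)// -(@ler_pXn2r _ 2) ?nnegrE ?sqrtr_ge0//.
by rewrite sqr_sqrtr ?dot_ge0// norm_le_dot.
Unshelve. all: by end_near. Qed.

(** The optimal step [t = dot g g / qform A g] decreases the cost by
    [(dot g g)^2 / (2 qform A g)], which the preconditioned Kantorovich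
    inequality compares with [qform H^-1 g], that is, with the gap. *)
Lemma gradient_step_contraction A H kappa kappa_max m M eps g (gap gap' : K) :
  pos_definite A -> pos_definite H ->
  is_max_eigenvalue (mxsqrt A *m invmx H *m mxsqrt A) kappa ->
  kappa <= kappa_max -> 0 < kappa_max -> 0 < m -> m <= M -> 0 < eps ->
  (forall x, m * dot x x <= qform A x) -> (forall x, qform A x <= M * dot x x) ->
  gap <= (1 + eps) / 2 * qform (invmx H) g ->
  (forall t, gap' <= gap - t * dot g g + 2^-1 * t ^+ 2 * qform A g) ->
  gap' <= (1 - ((1 + eps) * kappa_max)^-1 * (4 * (m * M) / (m + M) ^+ 2)) * gap.
Proof.
move=> A_pd H_pd kP kle k0 m0 mM eps0 Am AM gapH desc.
have M0 : 0 < M by exact: lt_le_trans mM.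
have kant := preconditioned_kantorovich A_pd H_pd kP g m0 mM kle (ltW k0) Am AM.
set rho := _^-1 * _.
have rho0 : 0 < rho.
  by rewrite /rho mulr_gt0 ?invr_gt0 ?divr_gt0 ?mulr_gt0 ?exprn_gt0 ?addr_gt0.
have [g0|g0] := eqVneq g 0.
  have : gap <= 0 by rewrite (le_trans gapH)// g0 qform0 mulr0.
  have := desc 0; rewrite expr0n/= mulr0 !mul0r subr0 addr0 => gap'le gap0.
  rewrite mulrBl mul1r (le_trans gap'le)// lerBrDl gerDr.
  by rewrite mulr_ge0_le0// ltW.
have gg0 := dot_gt0 g0.
have a0 : 0 < qform A g by rewrite (lt_le_trans _ (Am g))// mulr_gt0.
move: (desc (dot g g / qform A g)) kant gapH gg0 a0.
move: (dot g g) (qform A g) (qform (invmx H) g) => s a b.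
move=> step kant gapH s0 a0.
have {}step : gap' <= gap - s ^+ 2 / (2 * a).
  by rewrite (le_trans step)// le_eqVlt; apply/orP; left; apply/eqP; field; rewrite gt_eqF.
have : rho * gap <= s ^+ 2 / (2 * a).
  rewrite (@le_trans _ _ (rho * ((1 + eps) / 2 * b)))//.
    by rewrite ler_wpM2l// ltW.
  have -> : rho * ((1 + eps) / 2 * b) =
      (4 * (m * M) * (a * b)) / (kappa_max * (m + M) ^+ 2) / (2 * a).
    rewrite /rho; field.
    by rewrite !gt_eqF// addr_gt0.
  rewrite ler_pM2r ?invr_gt0 ?mulr_gt0//.
  by rewrite ler_pdivrMr ?mulr_gt0 ?exprn_gt0 ?addr_gt0// [leRHS]mulrC.
rewrite mulrBl mul1r; lra.
Qed.

End LinearRate.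

Theorem mainTheorem2 (K : realType) (N : nat)
    (R : 'M[K]_N) (r : 'cV[K]_N) (Psi : 'cV[K]_N -> K)
    (B : 'cV[K]_N -> 'M[K]_N) (V : 'M[K]_N)
    (M : nat -> nat) (D : forall n : nat, 'M[K]_(N, M n))
    (h : nat -> 'cV[K]_N)
    (eps eta_min eta_max : K) (kappa : nat -> K) :
  let F := cost R r Psi in
  let A := fun x : 'cV[K]_N => R + B x in
  let Theta := majorant F A in
  forall (R_pd : pos_definite R)
    (Psi_bounded : has_lbound (range Psi))
    (Psi_C2 : twice_continuously_differentiable Psi)
    (Psi_convex : convex_function setT Psi)
    (B_nnd : forall x : 'cV[K]_N, nonneg_definite (B x))
    (F_majorized : forall n : nat, (1 <= n)%N -> forall x : 'cV[K]_N,
       F x - F (h n) <= Theta x (h n) - Theta (h n) (h n))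
    (M_ge1 : forall n : nat, (1 <= n)%N -> (1 <= M n)%N)
    (h_step : forall n : nat, (1 <= n)%N ->
       argmin (fun x => Theta x (h n)) (ran (D n)) (h n.+1))
    (D_ran : forall n : nat, (1 <= n)%N ->
       ran (D n) (gradient F (h n)) /\ ran (D n) (h n))
    (V_pd : pos_definite V)
    (B_bounds : forall n : nat, (1 <= n)%N ->
       loewner_le (hessian Psi (h n)) (B (h n)) /\ loewner_le (B (h n)) V)
    (eps_gt0 : 0 < eps)
    (eps_R : loewner_lt eps%:M R)
    (eta_minP : is_min_eigenvalue R eta_min)
    (eta_maxP : is_max_eigenvalue (R + V) eta_max)
    (kappaP : forall n : nat, (1 <= n)%N ->
       is_max_eigenvalue
         (mxsqrt (A (h n)) *m invmx (hessian F (h n)) *m mxsqrt (A (h n)))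
         (kappa n)),
  exists hhat : 'cV[K]_N, argmin F setT = [set hhat] /\
  exists (n_eps : nat) (kappa_max : K),
    [/\ (1 <= n_eps)%N,
        1 <= kappa_max,
        forall n : nat, (n_eps <= n)%N -> kappa n <= kappa_max
      & let theta := 1 - ((1 + eps) * kappa_max)^-1 *
          (1 - ((eta_max - eta_min + 2 * eps) / (eta_max + eta_min)) ^+ 2) in
        let mu := (F (h n_eps) - inf (range F)) / theta ^+ n_eps in
        [/\ 0 < theta < 1,
            forall n : nat, (n_eps <= n)%N ->
              2^-1 * eta_min * norm2 (h n - hhat) ^+ 2 <= F (h n) - inf (range F)
              /\ F (h n) - inf (range F) <= mu * theta ^+ n
          & converges_linearly h hhat (Num.sqrt theta)]].
Proof.
move=> F A Theta R_pd _ Psi_C2 Psi_convex B_nnd F_maj _ h_step D_ran V_pd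
  B_bounds eps0 eps_R minP maxP kappaP.
set m := eta_min in minP *; set L := eta_max in maxP *.
have [dPsi dG _] := Psi_C2.
have Rm x : m * dot x x <= qform R x by exact: min_eigenvalue_qform R_pd.1 minP.
have RV_sym : (R + V)^T = R + V by rewrite linearD/= R_pd.1 V_pd.1.
have RVL x : qform (R + V) x <= L * dot x x by exact: max_eigenvalue_qform.
have [x0 x0_neq0 x0E] := eigenvalue_qform R_pd.1 minP.1.
have xx0 := dot_gt0 x0_neq0.
have eps_m : eps < m.
  by have := eps_R x0 x0_neq0; rewrite qform_scalar x0E ltr_pM2r.
have m0 : 0 < m by exact: lt_trans eps_m.
have mL : m <= L.
  rewrite -(ler_pM2r xx0) (le_trans _ (RVL x0))// qformD x0E lerDl.
  by apply: loewner_le0 => y; have [->|/V_pd.2/ltW] := eqVneq y 0; rewrite ?qform0.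
have L0 : 0 < L by exact: lt_le_trans mL.
have A_sym x : (A x)^T = A x by rewrite linearD/= R_pd.1 (B_nnd x).1.
have A_ge x y : qform R y <= qform (A x) y.
  by rewrite qformD lerDl; exact: loewner_le0 (B_nnd x).2.
have A_pd x : pos_definite (A x).
  by split=> // y y0; exact: lt_le_trans (R_pd.2 y y0) (A_ge x y).
have Am x y : m * dot y y <= qform (A x) y by exact: le_trans (Rm y) (A_ge x y).
have AL n y : (1 <= n)%N -> qform (A (h n)) y <= L * dot y y.
  move=> n1; rewrite (le_trans _ (RVL y))// !qformD lerD2l.
  exact: (B_bounds n n1).2.
have HE x : hessian F x = R + hessian Psi x by exact: hessian_cost R_pd.1 Psi_C2 x.
have H_ge x y : qform R y <= qform (hessian F x) y.
  by rewrite HE qformD lerDl; exact: convex_hessian_ge0.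
have H_pd x : pos_definite (hessian F x).
  split; first by rewrite HE linearD/= R_pd.1 hessian_sym.
  by move=> y y0; exact: lt_le_trans (R_pd.2 y y0) (H_ge x y).
have Hm x y : m * dot y y <= qform (hessian F x) y by exact: le_trans (H_ge x y).
have F_sc x d : F x + dot (gradient F x) d + 2^-1 * (m * dot d d) <= F (x + d).
  rewrite (le_trans _ (strongly_convex_cost r R_pd.1 Psi_C2 x d Psi_convex))//.
  by rewrite lerD2l ler_wpM2l.
have [z Fz] := strongly_convex_minimizer m0 F_sc.
have F_inf := inf_range_le m0 F_sc.
have growth x := quadratic_growth m0 F_sc x Fz.
pose gap n := F (h n) - inf (range F).
have gap_ge0 n : 0 <= gap n by rewrite subr_ge0.
have desc n t : (1 <= n)%N -> gap n.+1 <= gap n -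
    t * dot (gradient F (h n)) (gradient F (h n)) +
    2^-1 * t ^+ 2 * qform (A (h n)) (gradient F (h n)).
  move=> n1; have := mm_step_descent t (F_maj n n1 (h n.+1)) (h_step n n1)
    (D_ran n n1).1 (D_ran n n1).2.
  rewrite /gap; lra.
(* A fixed step 1 / L already decreases the gap geometrically, whence the
   convergence of the iterates; the sharper rate holds close to the limit. *)
have h_cvg : h @ \oo --> z.
  (* Half of the available decrease is given up to keep the ratio positive. *)
  pose q := 1 - m / L / 2.
  have mL1 : m / L <= 1 by rewrite ler_pdivrMr// mul1r.
  have mL0 : 0 < m / L by rewrite divr_gt0.
  have q01 : 0 < q < 1 by rewrite /q; apply/andP; split; lra.
  have gap_dec n : (1 <= n)%N -> gap n.+1 <= q * gap n.
    move=> n1; rewrite (le_trans (desc n L^-1 n1))//.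
    have := gradient_dominates_inf m0 F_sc (h n).
    have := AL n (gradient F (h n)) n1; rewrite -/(gap n).
    move: (dot _ _) (qform _ _) => g2 a aL gapg.
    have {}gapg : m * gap n <= 2^-1 * g2 by move: gapg; rewrite ler_pdivlMr ?mulr_gt0//; lra.
    have {}aL : 2^-1 * L^-1 ^+ 2 * a <= 2^-1 * (L^-1 * g2).
      rewrite (_ : 2^-1 * (_ * g2) = 2^-1 * L^-1 ^+ 2 * (L * g2)).
        by rewrite ler_wpM2l// mulr_ge0// exprn_ge0// invr_ge0 ltW.
      by field; rewrite gt_eqF.
    have {}gapg : m / L * gap n <= 2^-1 * (L^-1 * g2).
      by rewrite mulrAC [leRHS]mulrCA [leRHS]mulrC ler_wpM2r// invr_ge0 ltW.
    have := mulr_ge0 (ltW mL0) (gap_ge0 n); rewrite /q; lra.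
  have gapn := geometric_decay (proj1 (andP q01)) gap_dec.
  have [] // := @geometric_converges_linearly K N h z m (gap 1 / q ^+ 1) q 1 m0 q01.
  by move=> n /gapn; apply: le_trans; exact: growth.
have [rho rho0 newton] :=
  near_newton_decrement r z R_pd Psi_C2 Psi_convex m0 Rm eps0.
have [n1 _ near_z] : \forall n \near \oo, `|h n - z| < rho.
  by move/cvgrPdist_lt : h_cvg => /(_ _ rho0); under eq_near do rewrite distrC.
exists z; split.
  apply/seteqP; split => [y [_ ymin]|y ->]; last first.
    by split=> // y' _; rewrite Fz.
  have := growth y.
  have -> : F y = inf (range F) by apply/le_anti; rewrite F_inf andbT -Fz ymin.
  rewrite subrr => yz; apply/eqP; rewrite -subr_eq0; apply/negPn/negP.
  by move=> /dot_gt0; rewrite ltNge -(pmulr_rle0 _ (_ : 0 < 2^-1 * m)) ?yz// mulr_gt0.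
pose kmax := L / m.
have kmax1 : 1 <= kmax by rewrite ler_pdivlMr// mul1r.
have kmax0 : 0 < kmax by exact: lt_le_trans kmax1.
have kle n : (maxn 1 n1 <= n)%N -> kappa n <= kmax.
  rewrite geq_max => /andP[n1' _].
  by apply: (condition_number_le (A_pd (h n)) (H_pd (h n)) (kappaP n n1') m0) => y;
    [exact: Hm|exact: AL].
exists (maxn 1 n1), kmax; split=> //; first exact: leq_maxl.
move=> theta.
pose s := (L - m + 2 * eps) / (L + m).
have mLpos : 0 < L + m by exact: addr_gt0.
have s01 : 0 <= s < 1.
  apply/andP; split; first rewrite divr_ge0 ?(ltW mLpos)//.
    by rewrite addr_ge0 ?subr_ge0// mulr_ge0// ltW.
  by rewrite ltr_pdivrMr// mul1r; lra.
have theta01 : 0 < theta < 1.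
  have kk : 1 < (1 + eps) * kmax.
    rewrite (@lt_le_trans _ _ (1 + eps))// ?ltrDl//.
    by rewrite ler_peMr// addr_ge0// ltW.
  have kk0 := lt_trans ltr01 kk.
  have p0 : 0 < ((1 + eps) * kmax)^-1 by rewrite invr_gt0.
  have p1 : ((1 + eps) * kmax)^-1 < 1 by rewrite invf_lt1.
  have s2 : 0 < 1 - s ^+ 2 <= 1.
    rewrite subr_gt0 expr_lt1 ?(proj1 (andP s01))// (proj2 (andP s01))/=.
    by rewrite lerBlDr lerDl sqr_ge0.
  rewrite /theta -/s; move: (_^-1) (1 - _) p0 p1 s2 => p w p0 p1 /andP[w0 w1].
  have pw0 := mulr_gt0 p0 w0.
  have pw1 : p * w < 1 by rewrite (le_lt_trans _ p1)// ler_piMr// ltW.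
  by apply/andP; split; lra.
have contraction n : (maxn 1 n1 <= n)%N -> gap n.+1 <= theta * gap n.
  rewrite geq_max => /andP[n1' n1n].
  have gapn : gap n <= (1 + eps) / 2 *
      qform (invmx (hessian F (h n))) (gradient F (h n)).
    by rewrite /gap -Fz; apply: newton; exact: near_z.
  have := gradient_step_contraction (A_pd (h n)) (H_pd (h n)) (kappaP n n1')
    (kle n _) kmax0 m0 mL eps0 (Am (h n)) (fun y => AL n y n1') gapn
    (fun t => desc n t n1').
  rewrite geq_max n1' n1n => /(_ isT)/le_trans; apply.
  rewrite ler_wpM2r// /theta lerD2l lerN2.
  apply: ler_wpM2l; first by rewrite invr_ge0 mulr_ge0 ?addr_ge0// ltW.
  rewrite (_ : 4 * (m * L) / (m + L) ^+ 2 = 1 - ((L - m) / (L + m)) ^+ 2).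
    rewrite lerD2l lerN2 lerXn2r// ?nnegrE ?(proj1 (andP s01))//.
      by rewrite divr_ge0 ?subr_ge0// ltW.
    by rewrite ler_wpM2r ?invr_ge0 ?ltW// ltrDl mulr_gt0.
  by field; rewrite !gt_eqF// addr_gt0.
have theta0 : 0 < theta by case/andP: theta01.
move=> mu; have decay := geometric_decay theta0 contraction.
split=> // [n nn|].
  split; last exact: decay.
  by rewrite sqr_sqrtr ?dot_ge0//; exact: growth.
apply: (@geometric_converges_linearly _ _ h z m mu theta (maxn 1 n1)) => // n nn.
exact: le_trans (growth (h n)) (decay n nn).
Qed.
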